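(* Let $X$ be a real Hilbert space, let $A, B : X \rightrightarrows X$ be maximally monotone, let $w \in X$, $\gamma \in \,]0,1[$ and $\lambda \in \,]0,1]$. Suppose that $A$ is an affine relation. Then for every integer $n \ge 1$, $$R_{A_\gamma} T^{n}_{A_\gamma,B_\gamma} = T^{n}_{B_\gamma,A_\gamma} R_{A_\gamma}.$$
   Context: For a maximally monotone operator $C : X \rightrightarrows X$, the resolvent is $J_C = (\mathrm{Id} + C)^{-1}$ (a single-valued map on all of $X$) and the reflected resolvent is $R_C = 2J_C - \mathrm{Id}$. The operator $C$ is called an affine relation if its graph $\{(x,u) : u \in C(x)\}$ is an affine subspace of $X \times X$. Juxtaposition of maps denotes composition, and $T^n$ denotes the $n$-fold composition of $T$ with itself. For $C \in \{A,B\}$, the operator $C_\gamma : X \rightrightarrows X$ is defined by $$C_\gamma(x) = C\big(\gamma^{-1}(x - (1-\gamma)w)\big) + \gamma^{-1}(1-\gamma)(x - w).$$ It is known that $C_\gamma$ is maximally monotone, with $J_{C_\gamma} = \gamma J_C + (1-\gamma)w$ and $R_{C_\gamma} = 2\gamma J_C + 2(1-\gamma)w - \mathrm{Id}$. The Aragón Artacho–Campoy operators are $T_{A_\gamma,B_\gamma} = (1-\lambda)\mathrm{Id} + \lambda R_{B_\gamma} R_{A_\gamma}$ and $T_{B_\gamma,A_\gamma} = (1-\lambda)\mathrm{Id} + \lambda R_{A_\gamma} R_{B_\gamma}$. *)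

(* Defs.v *)
From HB Require Import structures.
From mathcomp Require Import all_boot all_order all_algebra.
From mathcomp Require Import boolp classical_sets reals topology normedtype.

Set Implicit Arguments.
Unset Strict Implicit.
Unset Printing Implicit Defensive.

Import Order.TTheory GRing.Theory Num.Theory.
Import numFieldNormedType.Exports.

Local Open Scope classical_set_scope.
Local Open Scope ring_scope.

(* A real Hilbert space is rendered as a complete normed module X over a
   realType R together with a positive definite symmetric bilinear form
   [dot : {dot X for idfun}] inducing its norm. *)
Definition induces_norm (R : realType) (X : completeNormedModType R)
    (dot : {dot X for idfun}) : Prop :=
  forall x : X, `|x| ^+ 2 = dot x x.

(* A set-valued operator X ⇉ X is a function X -> set X. *)

Definition op_graph (X : Type) (C : X -> set X) : set (X * X) :=
  [set p | C p.1 p.2].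

Definition op_inv (X : Type) (C : X -> set X) : X -> set X :=
  fun x => [set y | C y x].

Definition op_add (X : zmodType) (C D : X -> set X) : X -> set X :=
  fun x => [set u + v | u in C x & v in D x].

Definition op_id (X : Type) : X -> set X := fun x => [set x].

Section Operators.
Variables (R : realType) (X : completeNormedModType R).
Implicit Types (C D : X -> set X) (w x y u v : X) (g l : R).

Definition monotone_op (dot : {dot X for idfun}) C : Prop :=
  forall x y u v, C x u -> C y v -> 0 <= dot (x - y) (u - v).

Definition maximally_monotone (dot : {dot X for idfun}) C : Prop :=
  monotone_op dot C /\
  forall D, monotone_op dot D ->
    op_graph C `<=` op_graph D -> op_graph D = op_graph C.

Definition affine_subspace (V : lmodType R) (S : set V) : Prop :=
  S !=set0 /\
  forall (p q : V) (t : R), S p -> S q -> S ((1 - t) *: p + t *: q).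

Definition affine_relation C : Prop := affine_subspace (op_graph C).

Definition resolvent_op C : X -> set X := op_inv (op_add (@op_id X) C).

(* When C is maximally monotone, [resolvent_op C x] is a singleton for every
   x (Minty) and [resolvent C x] is its element; the default value 0 is only
   taken where [resolvent_op C x] is empty. *)
Definition resolvent C : X -> X := fun x => xget 0 (resolvent_op C x).

Definition reflected_resolvent C : X -> X :=
  fun x => 2 *: resolvent C x - x.

Definition op_gamma w g C : X -> set X :=
  fun x => [set u + (g^-1 * (1 - g)) *: (x - w)
           | u in C (g^-1 *: (x - (1 - g) *: w))].

(* The Aragón Artacho–Campoy operator
   T_{A_g,B_g} = (1 - l) Id + l R_{B_g} R_{A_g}; T_{B_g,A_g} is
   [AAC w g l B A]. *)
Definition AAC w g l (A B : X -> set X) : X -> X :=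
  fun x => (1 - l) *: x
    + l *: reflected_resolvent (op_gamma w g B)
             (reflected_resolvent (op_gamma w g A) x).

End Operators.

(* Main.v *)
Require Import Defs.
From HB Require Import structures.
From mathcomp Require Import all_boot all_order all_algebra.
From mathcomp Require Import boolp classical_sets reals topology normedtype.
From mathcomp Require Import sequences ring lra.

Set Implicit Arguments.
Unset Strict Implicit.
Unset Printing Implicit Defensive.

Import Order.TTheory GRing.Theory Num.Theory.
Import numFieldNormedType.Exports.

Local Open Scope classical_set_scope.
Local Open Scope ring_scope.

(* R_{A_gamma} is an affine map, because J_A is one when A is an affine
   relation; hence it commutes with the convex combination defining the
   operators: R_A T_{A,B} = (1 - lambda) R_A + lambda R_A R_B R_A = T_{B,A} R_A
   (all at level gamma), and one iterates.  What this needs is that J_A is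
   everywhere defined.  For an affine A, Minty's theorem has a short proof: the
   range of Id + A is convex, so if x were missed, the Cayley transform
   z + u |-> z - u could be extended to x as a nonexpansive map by its value at
   the projection of x on the closure of the range, contradicting maximality. *)

Section Hilbert.
Variables (R : realType) (X : completeNormedModType R).
Variables (dot : {dot X for idfun}) (hdot : induces_norm dot).
Implicit Types (x y z u v : X) (t : R).

(* The library's bilinearity lemmas leave syntactically different instances of
   the form on the two sides, on which [ring] fails. *)
Lemma dotDl x y z : dot (x + y) z = dot x z + dot y z.
Proof. exact: linearDl. Qed.

Lemma dotDr x y z : dot x (y + z) = dot x y + dot x z.
Proof. exact: linearDr. Qed.

Lemma dotNl x y : dot (- x) y = - dot x y.
Proof. exact: linearNl. Qed.

Lemma dotNr x y : dot x (- y) = - dot x y.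
Proof. exact: linearNr. Qed.

Lemma dotZl t x y : dot (t *: x) y = t * dot x y.
Proof. exact: linearZl_LR. Qed.

Lemma dotZr t x y : dot x (t *: y) = t * dot x y.
Proof. exact: linearZr_LR. Qed.

Let dotE := (dotDl, dotDr, dotNl, dotNr, dotZl, dotZr).

Lemma dotC x y : dot x y = dot y x.
Proof. by rewrite (hermC dot) expr0 mul1r. Qed.

(** Turns an identity between vectors into one between scalars, which [ring], [field] or [lra] can
    settle after bilinear expansion. *)
Lemma dot_ext x y : (forall v, dot v x = dot v y) -> x = y.
Proof.
move=> xy; apply/eqP; rewrite -subr_eq0 -normr_eq0 -sqrf_eq0 hdot.
by rewrite linearBr subr_eq0; apply/eqP/xy.
Qed.

Lemma dot_polarization x y :
  dot x y = 4^-1 * (`|x + y| ^+ 2 - `|x - y| ^+ 2).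
Proof. by rewrite !hdot !dotE (dotC y x); field. Qed.

Lemma sqr_norm_convex_comb x y z t :
  `|x - ((1 - t) *: y + t *: z)| ^+ 2 =
  (1 - t) * `|x - y| ^+ 2 + t * `|x - z| ^+ 2 - t * (1 - t) * `|y - z| ^+ 2.
Proof.
by rewrite !hdot !dotE (dotC y x) (dotC z x) (dotC z y); ring.
Qed.

Lemma resolvent_opE (C : X -> set X) x y : resolvent_op C x y <-> C y (x - y).
Proof.
split=> [[_ -> [v Cv <-]]|Cy]; first by rewrite addrC addKr.
by exists y => //; exists (x - y) => //; rewrite addrC subrK.
Qed.

(* Monotonicity says that the Cayley transform z + u |-> z - u of the graph is
   nonexpansive. *)
Lemma monotone_pairP z u z' u' :
  (0 <= dot (z - z') (u - u')) =
  (`|(z - u) - (z' - u')| <= `|(z + u) - (z' + u')|).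
Proof.
rewrite dot_polarization pmulr_rge0 ?invr_gt0 ?ltr0n // subr_ge0.
rewrite ler_sqr ?nnegrE // (addrACA z) -opprD; congr (`|_| <= _).
by rewrite !opprD !opprK addrACA.
Qed.

Section MonotoneAffine.
Variable A : X -> set X.
Hypotheses (hA : monotone_op dot A) (hAaff : affine_relation A).

(* The closest point to x in the (not yet known to be closed) range of Id + A
   need not be attained; the limit r of the Cayley transform along a minimizing
   sequence exists by completeness. *)
Lemma affine_cayley_extension x :
  exists r, forall z u, A z u -> `|(z - u) - r| <= `|(z + u) - x|.
Proof.
case: hAaff => -[[z0 u0] Ap0] Aff.
pose S (p : X * X) := p.1 + p.2; pose N (p : X * X) := p.1 - p.2.
pose E : set R := [set `|x - S p| ^+ 2 | p in op_graph A].
have E_inf : has_inf E.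
  split; first by exists (`|x - S (z0, u0)| ^+ 2), (z0, u0).
  by exists 0 => _ [p _ <-]; exact: exprn_ge0.
set d := inf E.
have d_ge0 : 0 <= d.
  by apply: lb_le_inf; [case: E_inf | move=> _ [p _ <-]; exact: exprn_ge0].
have d_le p : op_graph A p -> d <= `|x - S p| ^+ 2.
  by move=> Ap; apply: (ge_inf E_inf.2); exists p.
pose h n : R := n.+1%:R^-1.
have h_gt0 n : 0 < h n by rewrite invr_gt0 ltr0n.
have h_le1 n : h n <= 1 by rewrite invf_le1 ?ltr0n // ler1n.
(* The error is [h n ^+ 2] so that dividing by the weight [h n] in [bound] still leaves a null
   sequence. *)
have /choice[g gP] : forall n, exists p,
    op_graph A p /\ `|x - S p| ^+ 2 <= d + h n ^+ 2.
  move=> n; have h2 : 0 < h n ^+ 2 by rewrite exprn_gt0.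
  by have [_ [p Ap <-] /ltW lep] := inf_adherent h2 E_inf; exists p.
have NS p q : op_graph A p -> op_graph A q -> `|N p - N q| <= `|S p - S q|.
  by move=> Ap Aq; rewrite -monotone_pairP; apply: hA.
have SA t p q : S ((1 - t) *: p + t *: q) = (1 - t) *: S p + t *: S q.
  by rewrite /S /= addrACA -!scalerDr.
(* Affine combinations of [p] and [q] stay in the graph, so their image under [S] is at squared
   distance at least [d] from [x]. *)
have key t p q : op_graph A p -> op_graph A q ->
    d <= (1 - t) * `|x - S p| ^+ 2 + t * `|x - S q| ^+ 2
         - t * (1 - t) * `|S p - S q| ^+ 2.
  by move=> Ap Aq; rewrite -sqr_norm_convex_comb -SA d_le//; apply: Aff.
have Scauchy m n : `|S (g m) - S (g n)| ^+ 2 <= 2 * (h m ^+ 2 + h n ^+ 2).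
  have [[Am lem] [An len]] := (gP m, gP n).
  (* The midpoint gives the parallelogram estimate for minimizing sequences. *)
  have := key 2^-1 _ _ Am An; lra.
have cvgN : cvg (N (g n) @[n --> \oo]).
  apply/cauchy_cvgP/cauchy_exP => e e0.
  have h0 : \forall n \near \oo, h n < e / 2.
    have /cvgr_lt : (h n @[n --> \oo] --> (0 : R)) by exact: cvg_harmonic.
    by apply; rewrite divr_gt0.
  have [m hm] := filter_ex h0.
  exists (N (g m)); apply: filterS h0 => n hn.
  rewrite -ball_normE /=.
  apply: le_lt_trans (NS _ _ (gP m).1 (gP n).1) _.
  rewrite -ltr_sqr ?nnegrE ?(ltW e0) //.
  apply: le_lt_trans (Scauchy m n) _.
  have := h_gt0 m; have := h_gt0 n; nra.
exists (lim (N (g n) @[n --> \oo])) => z u Azu.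
set r := lim _.
rewrite -ler_sqr ?nnegrE //.
(* Moving from [g n] towards [(z, u)] by the small weight [h n] and dividing by [h n] gives an
   approximate variational inequality for the projection. *)
have bound n : (1 - h n) * `|N (z, u) - N (g n)| ^+ 2
    <= `|S (z, u) - x| ^+ 2 + h n.
  have [An len] := gP n.
  have Nle : `|N (z, u) - N (g n)| ^+ 2 <= `|S (z, u) - S (g n)| ^+ 2.
    by rewrite ler_sqr ?nnegrE // NS.
  have := key (h n) _ _ An (Azu : op_graph A (z, u)).
  rewrite (distrC x (S (z, u))) (distrC (S (g n))) => keyn.
  rewrite -(ler_pM2l (h_gt0 n)).
  have t0 := h_gt0 n; have t1 := h_le1 n.
  have c0 : 0 <= 1 - h n by rewrite subr_ge0.
  have := ler_wpM2l c0 len.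
  have := ler_wpM2l (mulr_ge0 (ltW t0) c0) Nle.
  have := mulr_ge0 (ltW t0) d_ge0.
  have := exprn_ge0 3 (ltW t0).
  by lra.
have h_cvg : h n @[n --> \oo] --> (0 : R) by exact: cvg_harmonic.
have Nz_cvg : `|N (z, u) - N (g n)| @[n --> \oo] --> `|N (z, u) - r|.
  by apply: cvg_norm; apply: cvgB => //; exact: cvg_cst.
have lhs_cvg : (1 - h n) * `|N (z, u) - N (g n)| ^+ 2 @[n --> \oo]
    --> (1 - 0) * `|N (z, u) - r| ^+ 2.
  apply: cvgM; first by apply: cvgB => //; exact: cvg_cst.
  exact: (cvgM Nz_cvg Nz_cvg).
have rhs_cvg : `|S (z, u) - x| ^+ 2 + h n @[n --> \oo]
    --> `|S (z, u) - x| ^+ 2 + 0 by apply: cvgD => //; exact: cvg_cst.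
have := ler_cvg_to lhs_cvg rhs_cvg (nearW _ bound).
rewrite subr0 mul1r addr0; apply.
Qed.

End MonotoneAffine.

Section MaximalAffine.
Variable A : X -> set X.
Hypotheses (hA : maximally_monotone dot A) (hAaff : affine_relation A).

Lemma affine_minty x : exists z, resolvent_op A x z.
Proof.
have [Amono Amax] := hA.
have [r rP] := affine_cayley_extension Amono hAaff x.
(* The pair whose sum is [x] and whose Cayley image is [r]; by [rP] adding it to the graph keeps
   monotonicity, so maximality puts it in [A]. *)
pose z := 2^-1 *: (x + r); pose u := 2^-1 *: (x - r).
have zDu : z + u = x by apply: dot_ext => v; rewrite !dotE; field.
have zBu : z - u = r by apply: dot_ext => v; rewrite !dotE; field.
pose D y := A y `|` [set v | y = z /\ v = u].
have zuP y v : A y v -> 0 <= dot (y - z) (v - u).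
  by move=> Ayv; rewrite monotone_pairP zDu zBu rP.
have Dmono : monotone_op dot D.
  move=> y y' v v' [Ayv|[-> ->]] [Ayv'|[-> ->]]; first exact: Amono.
  - exact: zuP.
  - by rewrite -opprB dotNl -dotNr opprB zuP.
  - by rewrite monotone_pairP !subrr.
exists z; apply/resolvent_opE; rewrite -{1}zDu addrC addKr.
suff : op_graph A (z, u) by [].
by rewrite -(Amax D Dmono) => [|[y v] Ayv]; [right | left].
Qed.

(** Both graph points have sum [x], so nonexpansiveness makes their Cayley images [2y - x] and
    [2z - x] equal. *)
Lemma resolvent_op_unique x y z :
  resolvent_op A x y -> resolvent_op A x z -> y = z.
Proof.
move=> /resolvent_opE Ay /resolvent_opE Az.
have := hA.1 _ _ _ _ Ay Az; rewrite monotone_pairP.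
rewrite !(addrC _ (x - _)) !subrK subrr normr0 normr_le0 subr_eq0 => /eqP yz.
apply: dot_ext => v; have := congr1 (dot v) yz; rewrite !dotE => H; lra.
Qed.

Lemma resolventP x : A (resolvent A x) (x - resolvent A x).
Proof. by apply/resolvent_opE; apply: xgetPex; exact: affine_minty. Qed.

(** The affine graph contains the combination of [(p, x - p)] and [(q, y - q)]; uniqueness of the
    resolvent value concludes. *)
Lemma resolvent_convex_comb t x y :
  resolvent A ((1 - t) *: x + t *: y)
  = (1 - t) *: resolvent A x + t *: resolvent A y.
Proof.
set p := resolvent A x; set q := resolvent A y.
apply: (resolvent_op_unique (x := (1 - t) *: x + t *: y)).
  exact/resolvent_opE/resolventP.
apply/resolvent_opE.
suff -> : (1 - t) *: x + t *: y - ((1 - t) *: p + t *: q)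
    = (1 - t) *: (x - p) + t *: (y - q).
  exact: (hAaff.2 (p, x - p) (q, y - q) t (resolventP x) (resolventP y)).
by apply: dot_ext => v; rewrite !dotE; ring.
Qed.

Lemma resolvent_op_gamma w g x : g != 0 ->
  resolvent (op_gamma w g A) x = g *: resolvent A x + (1 - g) *: w.
Proof.
move=> g0.
(* With [y = g z + (1 - g) w], the shift in [op_gamma] is exactly the difference between [x - y] and
   [x - z]. *)
have eqv y : resolvent_op (op_gamma w g A) x y <->
    resolvent_op A x (g^-1 *: (y - (1 - g) *: w)).
  set z := g^-1 *: _.
  have yE : y = g *: z + (1 - g) *: w.
    by rewrite scalerA divff // scale1r subrK.
  have xE : x - z + (g^-1 * (1 - g)) *: (y - w) = x - y.
    by apply: dot_ext => v; rewrite yE !dotE; field.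
  split=> [/resolvent_opE [v Av vE]|/resolvent_opE Az]; apply/resolvent_opE.
    suff -> : x - z = v by [].
    by apply: (addIr ((g^-1 * (1 - g)) *: (y - w))); rewrite xE.
  by exists (x - z).
(* A witness that the resolvent set is nonempty, so [xget] does not return its default 0. *)
have val_eqv :
    resolvent_op (op_gamma w g A) x (g *: resolvent A x + (1 - g) *: w).
  apply/eqv; rewrite addrK scalerA mulVf // scale1r.
  exact/resolvent_opE/resolventP.
have /eqv := xgetPex 0 (ex_intro _ _ val_eqv).
rewrite -/(resolvent _ _) => res.
have := resolvent_op_unique res ((resolvent_opE _ _ _).2 (resolventP x)).
by move=> <-; rewrite scalerA divff // scale1r subrK.
Qed.

Lemma reflected_resolvent_convex_comb w g t x y : g != 0 ->
  reflected_resolvent (op_gamma w g A) ((1 - t) *: x + t *: y)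
  = (1 - t) *: reflected_resolvent (op_gamma w g A) x
    + t *: reflected_resolvent (op_gamma w g A) y.
Proof.
move=> g0; rewrite /reflected_resolvent !resolvent_op_gamma //.
rewrite resolvent_convex_comb.
by apply: dot_ext => v; rewrite !dotE; ring.
Qed.

End MaximalAffine.
End Hilbert.

Theorem theorem2p6 (R : realType) (X : completeNormedModType R)
    (dot : {dot X for idfun}) (hdot : induces_norm dot)
    (A B : X -> set X)
    (hA : maximally_monotone dot A) (hB : maximally_monotone dot B)
    (w : X) (gamma lambda : R)
    (hgamma : gamma \in `]0, 1[) (hlambda : lambda \in `]0, 1])
    (hAaff : affine_relation A)
    (n : nat) (hn : (1 <= n)%N) :
  reflected_resolvent (op_gamma w gamma A) \o iter n (AAC w gamma lambda A B)
  = iter n (AAC w gamma lambda B A) \o reflected_resolvent (op_gamma w gamma A).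
Proof.
have gamma_neq0 : gamma != 0.
  by move: hgamma; rewrite in_itv /= => /andP[/lt0r_neq0].
apply/funext => x /=; elim: n {hn} => //= n <-.
(* Unfolding both [AAC] leaves the combination of [x'] and [R_B R_A x'] with [t = lambda], where
   [x'] is the [n]-th iterate. *)
exact: (reflected_resolvent_convex_comb hdot hA hAaff).
Qed.
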